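(* Let $n, r, q \ge 1$ be integers, let $c\colon \mathbb{R}^r \to \mathbb{R}^q$ be the smooth clustering network $$c(\rho) = \operatorname{softmax}\bigl(F_c(\rho) + \hat e_1\bigr), \qquad F_c(\rho) = \mathsf{ELU}(\mathsf{FC}(\rho)),$$ where $\mathsf{FC}\colon \mathbb{R}^r\to\mathbb{R}^q$ is a linear map (fully connected layer without bias), $\mathsf{ELU}$ is applied componentwise, and $\hat e_1$ is the first canonical unit vector of $\mathbb{R}^q$ (the functions $\operatorname{softmax}$ and $\mathsf{ELU}$ are as defined in the context). Let $W \in \mathbb{R}^{n\times qr}$ be a matrix, let $\widetilde A\colon \mathbb{R}^n \to \mathbb{R}^{n\times n}$ be a linear map, and define the coefficient function $$A\colon \mathbb{R}^r \to \mathbb{R}^{n\times n}, \qquad A(\rho) = \widetilde A\bigl( W\,(c(\rho)\otimes\rho)\bigr).$$ Then: (a) the function $A$ is differentiable; (b) the Jacobian of $c$ at $\rho = 0$ is zero, i.e. $c'(\rho)\big|_{\rho=0} = 0 \in \mathbb{R}^{q\times r}$; (c) the second-order Taylor expansion of $A$ around $\rho = 0$ coincides with its first-order expansion and is given by $$A(0) + \sum_{j=1}^{r} \rho_j\, \widetilde A(w_j),$$ where $w_1,\dots,w_r \in \mathbb{R}^n$ are the first $r$ columns of $W$; that is, $$A(\rho) = A(0) + \sum_{j=1}^{r} \rho_j\, \widetilde A(w_j) + o(\|\rho\|^2) \quad \text{as } \rho\to 0.$$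
   Context: The symbol $\otimes$ denotes the Kronecker product: for $a\in\mathbb{R}^q$ and $\rho\in\mathbb{R}^r$, $a\otimes\rho = (a_1\rho^{\mathsf T}, a_2\rho^{\mathsf T},\dots,a_q\rho^{\mathsf T})^{\mathsf T}\in\mathbb{R}^{qr}$. The function called $\operatorname{softmax}$ here is not the usual exponential one. It is defined for $\xi=(\xi_1,\dots,\xi_q)\in\mathbb{R}^q$, $\xi\neq 0$, by $$\operatorname{softmax}(\xi)_i = \frac{\xi_i\tanh(10\,\xi_i)}{\sum_{j=1}^{q}\xi_j\tanh(10\,\xi_j)}, \qquad i=1,\dots,q.$$ The exponential linear unit is the scalar function $\mathsf{ELU}(z) = z$ for $z>0$ and $\mathsf{ELU}(z) = e^{z}-1$ for $z\le 0$, applied to vectors componentwise. *)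

(* Defs.v *)
From HB Require Import structures.
From mathcomp Require Import all_boot all_order all_algebra.
From mathcomp Require Import all_classical all_reals all_analysis.
From mathcomp.real_closed Require Import mxtens.

Set Implicit Arguments.
Unset Strict Implicit.
Unset Printing Implicit Defensive.

Import Order.TTheory GRing.Theory Num.Theory.
Import numFieldNormedType.Exports.

Local Open Scope classical_set_scope.
Local Open Scope ring_scope.

Definition tanh {R : realType} (x : R) : R :=
  (expR x - expR (- x)) / (expR x + expR (- x)).

(* The denominator vanishes only at [xi = 0], where division by zero makes
   [softmax xi] the zero vector. *)
Definition softmax {R : realType} {q : nat} (xi : 'cV[R]_q) : 'cV[R]_q :=
  \col_i ((xi i 0 * tanh (10 * xi i 0)) /
          \sum_(j < q) (xi j 0 * tanh (10 * xi j 0))).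

Definition ELU {R : realType} (z : R) : R :=
  if 0 < z then z else expR z - 1.

(* The first unit vector, written so as to make sense for every [q]; it is
   [delta_mx 0 0] when [q] has the form [q'.+1]. *)
Definition e1 {R : realType} {q : nat} : 'cV[R]_q := \col_i (val i == 0)%:R.

Definition clustering {R : realType} {r q : nat}
    (FC : {linear 'cV[R]_r -> 'cV[R]_q}) (rho : 'cV[R]_r) : 'cV[R]_q :=
  softmax (map_mx ELU (FC rho) + e1).

(* [a *t rho] has [1 * 1] columns, which is convertible to [1]; its entry of
   index [i * r + j] is [a_i * rho_j]. *)
Definition kron {R : realType} {q r : nat}
    (a : 'cV[R]_q) (rho : 'cV[R]_r) : 'cV[R]_(q * r) := a *t rho.

Definition coef {R : realType} {n r q : nat}
    (FC : {linear 'cV[R]_r -> 'cV[R]_q}) (W : 'M[R]_(n, q * r))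
    (At : {linear 'cV[R]_n -> 'M[R]_n}) (rho : 'cV[R]_r) : 'M[R]_n :=
  At (W *m kron (clustering FC rho) rho).

(* The library's ['J f x] is stated for row vectors, and its matrix acts on the
   right; this is its transpose, for maps between column vectors. *)
Definition jacobian_cV {R : realType} {q r : nat}
    (f : 'cV[R]_r -> 'cV[R]_q) (x : 'cV[R]_r) : 'M[R]_(q, r) :=
  \matrix_(i, j) ('d f x (delta_mx j 0 : 'cV[R]_r)) i 0.

Section Taylor.
Context {R : realType} {r : nat} {V : normedModType R}.
Implicit Types (f : 'cV[R]_r -> V) (x h : 'cV[R]_r).

(* Since the domain is finite dimensional, differentiability of
   [y |-> 'd f y] at [x] amounts to that of [y |-> 'd f y h] for every [h]. *)
Definition twice_differentiable f x : Prop :=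
  (\forall y \near x, differentiable f y) /\
  (forall h, differentiable (fun y => 'd f y h : V) x).

Definition diff2 f x h k : V := 'd (fun y => 'd f y h : V) x k.

Definition taylor1 f x h : V := f x + 'd f x h.

Definition taylor2 f x h : V := f x + 'd f x h + 2^-1 *: diff2 f x h h.

End Taylor.

(* Main.v *)
Require Import Defs.
From HB Require Import structures.
From mathcomp Require Import all_boot all_order all_algebra.
From mathcomp Require Import all_classical all_reals all_analysis.
From mathcomp.real_closed Require Import mxtens.
From mathcomp Require Import lra.

(* The argument of softmax never vanishes because ELU > -1, and ELU is C^1, so
   every coordinate of c is C^1. Its values lie in [0, 1] and c(0) is the first
   unit vector, so each coordinate of c has an extremum at 0 and c'(0) = 0.
   Now A(rho) is a combination of products c_i(rho) rho_j, and for a C^1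
   function u with u'(0) = 0 and a continuous linear form l, the differential
   of u l is u l(h) + l u'(h), whose second term is o(y) at 0: thus u l has a
   vanishing second derivative at 0, although u need not be twice
   differentiable (ELU is not). *)

Set Implicit Arguments.
Unset Strict Implicit.
Unset Printing Implicit Defensive.

Import Order.TTheory GRing.Theory Num.Theory.
Import numFieldNormedType.Exports.

Local Open Scope classical_set_scope.
Local Open Scope ring_scope.

(** * Continuously differentiable real-valued functions on a normed space *)

Section C1.
Context {R : realType} {V : normedModType R}.
Implicit Types (f g : V -> R) (x h : V).

(** Continuity of the derivative is asked direction by direction; for finite-dimensional [V] this
    amounts to continuity in operator norm. *)
Definition C1 f : Prop :=
  (forall x, differentiable f x) /\
  (forall h, continuous (fun x => 'd f x h : R)).

Lemma C1_is_diff f (df : V -> V -> R) :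
  (forall x, is_diff x f (df x)) -> (forall h, continuous (df ^~ h)) -> C1 f.
Proof.
move=> fd dfc; split=> [x|h]; first exact: ex_diff.
rewrite (_ : (fun x => _) = df ^~ h) //; apply/funext => x.
by rewrite diff_val.
Qed.

Lemma C1_continuous f : C1 f -> continuous f.
Proof. by move=> [df _] x; exact: differentiable_continuous. Qed.

Lemma C1_cst (a : R) : C1 (cst a).
Proof. by apply: (@C1_is_diff _ (fun _ => 0)) => // h x; exact: cvg_cst. Qed.

Lemma C1D f g : C1 f -> C1 g -> C1 (fun x => f x + g x).
Proof.
move=> [df cf] [dg cg].
pose dfg x h : R := 'd f x h + 'd g x h.
have dfgE x : is_diff x (fun y => f y + g y) (dfg x).
  by apply: DiffDef; [exact: differentiableD|exact: diffD].
by apply: (C1_is_diff dfgE) => h x; apply: cvgD; [exact: cf|exact: cg].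
Qed.

Lemma C1M f g : C1 f -> C1 g -> C1 (fun x => f x * g x).
Proof.
move=> Cf Cg; have [[df cf] [dg cg]] := (Cf, Cg).
pose dfg x h : R := f x * 'd g x h + g x * 'd f x h.
have dfgE x : is_diff x (fun y => f y * g y) (dfg x).
  by apply: DiffDef; [exact: differentiableM|exact: diffM].
apply: (C1_is_diff dfgE) => h x; apply: cvgD; apply: cvgM.
- exact: C1_continuous.
- exact: cg.
- exact: C1_continuous.
- exact: cf.
Qed.

Lemma C1_sum (I : Type) (s : seq I) (F : I -> V -> R) :
  (forall i, C1 (F i)) -> C1 (fun x => \sum_(i <- s) F i x).
Proof.
move=> CF; elim: s => [|i s ih].
  by under eq_fun do rewrite big_nil; exact: (C1_cst 0).
by under eq_fun do rewrite big_cons; exact: (C1D (CF i) ih).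
Qed.

Lemma C1_comp (phi dphi : R -> R) f :
  (forall z : R, is_derive z 1 phi (dphi z)) -> continuous dphi ->
  C1 f -> C1 (phi \o f).
Proof.
move=> dphiE dphic Cf; have [df cf] := Cf.
apply: (@C1_is_diff _ (fun x h => ('d f x h : R) * dphi (f x))).
  move=> x; have dp : differentiable phi (f x) by apply/derivable1_diffP.
  apply: DiffDef; first exact: differentiable_comp.
  rewrite diff_comp //; apply/funext => h /=.
  by rewrite diff1E // derive1E derive_val.
move=> h x; apply: cvgM; first exact: cf.
by apply: continuous_comp; [exact: C1_continuous|exact: dphic].
Qed.

Lemma C1V f : (forall x, f x != 0) -> C1 f -> C1 (fun x => (f x)^-1).
Proof.
move=> f0 Cf; have [df cf] := Cf.
apply: (@C1_is_diff _ (fun x h => - (f x) ^- 2 * ('d f x h : R))).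
  move=> x; apply: DiffDef; first exact: differentiableV.
  by rewrite diffV.
move=> h x; apply: cvgM; last exact: cf.
apply: cvgN; apply: cvgV; first by rewrite expf_neq0.
by rewrite expr2; apply: cvgM; exact: C1_continuous.
Qed.

Lemma C1_linear (l : {linear V -> R}) : continuous l -> C1 l.
Proof.
move=> lc; apply: (@C1_is_diff _ (fun _ => l)) => [x|h x]; last exact: cvg_cst.
by apply: DiffDef; [exact: linear_differentiable|exact: diff_lin].
Qed.

Lemma C1N f : C1 f -> C1 (fun x => - f x).
Proof.
move=> Cf; have := C1M (C1_cst (-1)) Cf.
by congr C1; apply/funext => x; rewrite mulN1r.
Qed.

Lemma C1_tanh f : C1 f -> C1 (fun x => tanh (f x)).
Proof.
have Cexp g : C1 g -> C1 (fun x => expR (g x)).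
  exact: (@C1_comp expR expR g (@is_derive_expR R) (@continuous_expR R)).
move=> Cf; have [Ce CeN] := (Cexp _ Cf, Cexp _ (C1N Cf)).
apply: (C1M (C1D Ce (C1N CeN)) (C1V _ (C1D Ce CeN))) => x.
by rewrite gt_eqF // addr_gt0 // expR_gt0.
Qed.

(** Restriction to the line [t *: h + x] reduces the claim to Fermat's theorem in one variable: by
    the chain rule the derivative of [f \o a] at 0 is ['d f x h]. *)
Lemma diff_at_max f x :
  (forall y, differentiable f y) -> (forall y, f y <= f x) ->
  'd f x = 0 :> (V -> R).
Proof.
move=> df fmax; apply/funext => h.
pose a (t : R) : V := t *: h + x.
have da t : is_diff t a ( *:%R ^~ h).
  apply: is_diff_eq (is_diffD (is_diff_scalel _ _) (is_diff_cst x _)) _.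
  by rewrite addr0.
have a0 : a 0 = x by rewrite /a scale0r add0r.
have dfa t : differentiable (f \o a) t by exact: differentiable_comp.
rewrite -[RHS]/(0 : R); have [_ <-] : is_derive (0 : R) 1 (f \o a) 0.
  (* The maximum is global, so any open interval around 0 would serve. *)
  apply: (@derive1_at_max _ _ (-1) 1) => // [t _||t _].
  - exact/derivable1_diffP.
  - by rewrite in_itv /=; apply/andP; split; lra.
  - by rewrite /= /a scale0r add0r.
rewrite deriveE // [in RHS]diff_comp //= a0; case: (da 0) => _ ->.
by rewrite scale1r.
Qed.

Lemma diff_at_min f x :
  (forall y, differentiable f y) -> (forall y, f x <= f y) ->
  'd f x = 0 :> (V -> R).
Proof.
move=> df fmin.
have fN y : (- f) y <= (- f) x by rewrite lerN2.
have := @diff_at_max (- f) x (fun y => differentiableN (df y)) fN.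
by rewrite diffN // => /eqP; rewrite oppr_eq0 => /eqP.
Qed.

End C1.

(** * Functions with vanishing second derivative at 0 *)

Section flat.
Context {R : realType} {U W : normedModType R}.

(** The bound at [y = 0] forces [f 0 = 0], so the hypothesis is a first-order expansion with null
    linear part, and differentials are unique. *)
Lemma littleo_is_diff0 (f : U -> W) :
  (forall e, 0 < e -> \forall y \near 0, `|f y| <= e * `|y|) -> is_diff 0 f 0.
Proof.
move=> fo.
have f0 : f 0 = 0.
  have /nbhs_singleton := fo 1 ltr01.
  by rewrite normr0 mulr0 normr_le0 => /eqP.
have [c0 _] := @dcst R U W 0 (0 : U).
have fE : f \o shift 0 = cst (f 0) + (\0 : U -> W) +o_ 0 id.
  apply/eqaddoP => e e0; apply: filterS (fo e e0) => y.
  by rewrite /= !fctE /= addr0 f0 add0r subr0.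
have d0 := @diff_unique _ _ _ _ \0 _ c0 fE.
by apply: DiffDef => //; apply/diff_locallyP; rewrite d0.
Qed.

(** Everything to be shown about [A] at 0, in a form stable under sums and under multiplication by a
    fixed vector. The remainder bound is carried along and estimated directly, not deduced from
    Taylor's theorem. *)
Definition flat2 (f df : U -> W) : Prop :=
  [/\ forall x, differentiable f x,
      'd f 0 = df :> (U -> W),
      forall h, is_diff 0 (fun y => 'd f y h : W) 0
    & (fun x => f x - (f 0 + df x)) =o_ (0 : U) (fun x => `|x| ^+ 2 : R)].

End flat.

Section flat_theory.
Context {R : realType} {U : normedModType R}.

Lemma flat2Zl {W : normedModType R} (k dk : U -> R) (w : W) :
  flat2 k dk -> flat2 (fun x => k x *: w) (fun x => dk x *: w).
Proof.
move=> [kd <- ddk ko]; split.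
- by move=> x; exact: differentiableZl.
- by rewrite diffZl.
- move=> h; under eq_fun do rewrite diffZl //.
  have := ddk h; move=> [d1 d2]; apply: DiffDef.
    exact: differentiableZl.
  by rewrite diffZl // d2; apply/funext => ? /=; rewrite scale0r.
- apply/eqoP => e e0.
  (* The summand 1 keeps the divisor positive when [w = 0]. *)
  have e0' : 0 < e / (1 + `|w|) by rewrite divr_gt0 // ltr_wpDr.
  move/eqoP : ko => /(_ _ e0'); apply: filterS => x.
  rewrite -scalerDl -scalerBl (normrZ (k x - _) w).
  move/(ler_wpM2r (normr_ge0 w))/le_trans; apply; rewrite mulrAC ler_wpM2r //.
  rewrite mulrAC ler_pdivrMr ?ltr_wpDr // ler_wpM2l ?ltW //.
  by rewrite ltrDr.
Qed.

Lemma flat2_cst {W : normedModType R} (a : W) : flat2 (cst a : U -> W) 0.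
Proof.
split=> //.
- exact: diff_cst.
- move=> h; under eq_fun do rewrite diff_cst; exact: is_diff_cst.
- apply/eqoP => e e0; apply: nearW => x.
  by rewrite addr0 subrr normr0 mulr_ge0 // ltW.
Qed.

Lemma flat2D {W : normedModType R} (f df g dg : U -> W) :
  flat2 f df -> flat2 g dg -> flat2 (f \+ g) (df \+ dg).
Proof.
move=> [fd <- ddf fo] [gd <- ddg go]; split.
- by move=> x; exact: differentiableD.
- by rewrite diffD.
- move=> h; under eq_fun do rewrite diffD //.
  by apply: is_diff_eq (is_diffD (ddf h) (ddg h)) _; rewrite addr0.
- apply/eqoP => e e0; have e2 : 0 < e / 2 by rewrite divr_gt0.
  move/eqoP: go => /(_ _ e2); move/eqoP: fo => /(_ _ e2).
  apply: filterS2 => x /= fx gx; rewrite (addrACA (f 0)) opprD addrACA.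
  by rewrite (le_trans (ler_normD _ _)) // [e]splitr mulrDl lerD.
Qed.

Lemma flat2_sum {W : normedModType R} (I : Type) (s : seq I)
    (F dF : I -> U -> W) :
  (forall i, flat2 (F i) (dF i)) ->
  flat2 (fun x => \sum_(i <- s) F i x) (fun x => \sum_(i <- s) dF i x).
Proof.
move=> flatF.
have sumE t (G : I -> U -> W) :
    (fun x => \sum_(i <- t) G i x) = \sum_(i <- t) G i.
  by apply/funext => x; rewrite fct_sumE.
rewrite !sumE; elim: s => [|i s ih].
  by rewrite !big_nil; exact: flat2_cst.
by rewrite !big_cons; exact: flat2D.
Qed.

Lemma flat2_mul (u : U -> R) (l : {linear U -> R}) :
  C1 u -> 'd u 0 = 0 :> (U -> R) -> continuous l ->
  flat2 (fun x => u x * l x) (fun x => u 0 * l x).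
Proof.
move=> [du cu] du0 lc.
have dl x : differentiable l x by exact: linear_differentiable.
pose ul x := u x * l x.
have dul x h : 'd ul x h = u x * l h + l x * 'd u x h.
  have -> : 'd ul x h = u x * 'd l x h + l x * 'd u x h.
    exact: (congr1 (@^~ h) (diffM (du x) (dl x))).
  by rewrite (diff_lin x lc).
(* [k] is a positive Lipschitz constant of [l]; tolerances [e / k] below compensate for it. *)
have [k k0 lk] := linear_lipschitz lc.
split.
- by move=> x; exact: differentiableM.
- by apply/funext => x; rewrite dul linear0 mul0r addr0.
- move=> h; under eq_fun do rewrite dul.
  (* Here [l h] is a constant, so the differential at 0 is a multiple of ['d u 0]. *)
  have : is_diff 0 (fun y => u y * l h) 0.
    apply: DiffDef; first exact: (@differentiableZl _ _ _ u (l h : R^o)).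
    rewrite (@diffZl _ _ _ u (l h : R^o)) // du0.
    by apply/funext => x /=; rewrite scale0r.
  (* The factor [l y] is bounded by [k] times the norm of [y], and ['d u y h] tends to
     ['d u 0 h = 0], so no derivative of ['d u] is taken. *)
  have : is_diff 0 (fun y => l y * 'd u y h) 0.
    apply: littleo_is_diff0 => e e0.
    have /cvgr0Pnorm_le/(_ (e / k)) : (fun y => 'd u y h : R) @ 0 --> (0 : R).
      by have := cu h 0; rewrite /continuous_at du0.
    rewrite divr_gt0 // => /(_ isT); apply: filterS => y duh.
    rewrite normrM; apply: le_trans (ler_pM _ _ (lk y) duh) _ => //.
    by rewrite mulrAC [k * _]mulrC divfK ?gt_eqF.
  move=> d1 d2; apply: is_diff_eq (is_diffD d2 d1) _.
  by rewrite addr0.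
(* The remainder is [(u x - u 0) * l x], where the first factor is o(x) because ['d u 0 = 0] and the
   second is O(x). *)
- apply/eqoP => e e0.
  have ek0 : 0 < e / k by rewrite divr_gt0.
  have /eqaddoP/(_ _ ek0) := diff_locally (du 0).
  apply: filterS => x; rewrite /= du0 !fctE /= !addr0 => ux.
  rewrite linear0 mulr0 add0r -mulrBl normrM.
  apply: le_trans (ler_pM _ _ ux (lk x)) _ => //.
  by rewrite mulrACA divfK ?gt_eqF // normrX normr_id expr2.
Qed.

End flat_theory.

(** * The scalar functions ELU, tanh and x tanh(10 x) *)

Section scalar_functions.
Context {R : realType}.
Implicit Types x : R.

(** Writing the derivative with [Num.min] covers both branches by one formula, which makes its
    continuity immediate. *)
Lemma is_derive_ELU x : is_derive x (1 : R) (@ELU R) (expR (Num.min x 0)).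
Proof.
have dexp (y : R) : is_derive y 1 (fun z : R => expR z - 1) (expR y).
  have dcst := @is_derive_cst R R R 1 y 1.
  by apply: is_derive_eq (is_deriveB (is_derive_expR y) dcst) _; rewrite subr0.
have [x0|x0|->] := ltgtP x 0.
- apply: near_eq_is_derive (dexp x).
  near=> y; rewrite /ELU ifF //; apply/negbTE; rewrite -leNgt.
  by near: y; exact: lt_le_nbhsl.
- rewrite expR0; apply: near_eq_is_derive (is_derive_id x 1).
  by near=> y; rewrite /ELU ifT //; near: y; exact: lt_nbhsr.
- rewrite expR0.
  (* At the junction the two branches are treated together: [ELU z - z] is 0 for positive [z] and
     the first-order remainder of exp otherwise, hence o(z). *)
  have dr : is_diff 0 (fun z : R => ELU z - z) 0.
    apply: littleo_is_diff0 => e e0.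
    have [d1 d2] := dexp 0.
    have /derivable_nbhsP/eqaddoP/(_ _ e0) := d1.
    apply: filterS => y; rewrite d2 expR0 !fctE /= addr0 subrr add0r.
    rewrite [y%:A]mulr1 /ELU; case: ifP => // _ _.
    by rewrite subrr normr0 mulr_ge0 // ltW.
  have dE : is_diff 0 (@ELU R) id.
    have := is_diffD dr (is_diff_id 0); rewrite add0r; congr is_diff_def.
    by apply/funext => z /=; rewrite fctE subrK.
  have dE0 : differentiable (@ELU R) 0 by exact: ex_diff.
  by apply: DeriveDef; [exact: diff_derivable|rewrite deriveE // diff_val].
Unshelve. all: by end_near. Qed.

Lemma continuous_expR_min0 : continuous (fun x => expR (Num.min x 0)).
Proof.
move=> x; apply: (@continuous_comp _ _ _ (fun x : R => Num.min x 0)).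
  apply: (@continuous_min _ R (fun x : R => x) (fun=> 0)); first exact: cvg_id.
  exact: cvg_cst.
exact: continuous_expR.
Qed.

Lemma C1_ELU (V : normedModType R) (f : V -> R) :
  C1 f -> C1 (fun v => ELU (f v)).
Proof. exact: (C1_comp is_derive_ELU continuous_expR_min0). Qed.

Lemma ELU_gtN1 x : -1 < ELU x.
Proof.
rewrite /ELU; case: (ltP 0 x) => [x0|_]; first lra.
by rewrite ltrBrDl subrr expR_gt0.
Qed.

Lemma ELU0 : ELU 0 = 0 :> R.
Proof. by rewrite /ELU ltxx expR0 subrr. Qed.

Lemma tanh_gt0 x : 0 < x -> 0 < tanh x.
Proof.
move=> x0; apply: divr_gt0; last by rewrite addr_gt0 // expR_gt0.
by rewrite subr_gt0 ltr_expR gtrN.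
Qed.

Lemma tanhN x : tanh (- x) = - tanh x.
Proof. by rewrite /tanh opprK -mulNr opprB [expR x + _]addrC. Qed.

(** The weight that [softmax] normalizes. *)
Definition xtanh x := x * tanh (10 * x).

Lemma xtanh_gt0 x : x != 0 -> 0 < xtanh x.
Proof.
rewrite /xtanh.
(* A product of two odd functions is even, so negative [x] reduces to [- x]. *)
wlog xpos : x / 0 < x => [H x0|_].
  have [x_lt0|x_gt0|xE] := ltgtP x 0; last by rewrite xE eqxx in x0.
    by have := H (- x); rewrite mulrN tanhN mulrNN oppr_gt0 oppr_eq0; apply.
  exact: H.
by rewrite mulr_gt0 // tanh_gt0 // mulr_gt0.
Qed.

Lemma xtanh_ge0 x : 0 <= xtanh x.
Proof.
have [->|/xtanh_gt0/ltW//] := eqVneq x 0.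
by rewrite /xtanh mul0r.
Qed.

End scalar_functions.

(** * Linear maps, coordinates and differentials on column vectors *)

Lemma linear_continuous_cV {R : realType} r (W : normedModType R)
  (l : {linear 'cV[R]_r -> W}) : continuous l.
Proof.
have -> : (l : _ -> _) = fun v => \sum_j v j 0 *: l (delta_mx j 0).
  apply/funext => v; rewrite {1}[v]matrix_sum_delta linear_sum.
  by apply: eq_bigr => j _; rewrite big_ord1 linearZ.
apply: continuous_big => [|j _]; first exact: add_continuous.
move=> v; apply: (@continuous_comp 'cV[R]_r R W (fun u => u j 0) ( *:%R^~ _)).
  exact: coord_continuous.
exact: scalel_continuous.
Qed.

Section coord.
Context {R : realType} {q : nat} (i : 'I_q).

(** Naming the coordinate form lets it carry the linear structure that [C1_linear] and [flat2_mul]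
    require. *)
Definition coord_cV (v : 'cV[R]_q) : R := v i 0.

Fact coord_cV_is_linear : linear coord_cV.
Proof. by move=> a u v; rewrite /coord_cV !mxE. Qed.

HB.instance Definition _ :=
  GRing.isLinear.Build R 'cV[R]_q R _ coord_cV coord_cV_is_linear.

End coord.

Lemma is_diff_cV {R : realType} {V : normedModType R} q
    (f df : V -> 'cV[R]_q) x :
  (forall i, is_diff x (fun y => f y i 0) (fun y => df y i 0)) ->
  is_diff x f df.
Proof.
move=> fd.
have E (g : V -> 'cV[R]_q) : g = \sum_i (fun y => g y i 0 *: delta_mx i 0).
  apply/funext => y; rewrite fct_sumE {1}[g y]matrix_sum_delta.
  by apply: eq_bigr => i _; rewrite big_ord1.
rewrite [f]E [df]E; elim/big_ind2 : _ => [|? ? ? ?|i _].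
- exact: is_diff_cst.
- exact: is_diffD.
- have [d1 d2] := fd i.
  apply: DiffDef; first exact: differentiableZl.
  by rewrite diffZl // d2.
Qed.

Lemma mulmx_sum_col (R : comPzRingType) m n (A : 'M[R]_(m, n)) (v : 'cV[R]_n) :
  A *m v = \sum_j v j 0 *: col j A.
Proof.
apply/matrixP => i k; rewrite ord1 mxE summxE.
by apply: eq_bigr => j _; rewrite !mxE mulrC.
Qed.

(** * The clustering network and the coefficient function *)

Section clustering.
Context {R : realType} {r q : nat} (FC : {linear 'cV[R]_r -> 'cV[R]_q}).
Context (q_gt0 : (0 < q)%N).
Implicit Types rho : 'cV[R]_r.

Definition logit i rho : R := ELU (FC rho i 0) + (val i == 0)%:R.

Lemma clusteringE rho i :
  clustering FC rho i 0 = xtanh (logit i rho) / \sum_j xtanh (logit j rho).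
Proof.
rewrite /clustering /softmax !mxE; congr (_ / _).
by apply: eq_bigr => j _; rewrite !mxE.
Qed.

(** All weights are nonnegative, and the one of index 0 is positive since its logit is an ELU value
    plus 1. *)
Lemma clustering_den_gt0 rho : 0 < \sum_j xtanh (logit j rho).
Proof.
rewrite (bigD1 (Ordinal q_gt0)) //= ltr_wpDr //.
  by apply: sumr_ge0 => j _; exact: xtanh_ge0.
apply: xtanh_gt0; rewrite gt_eqF // /logit /=.
by have := ELU_gtN1 (FC rho (Ordinal q_gt0) 0); lra.
Qed.

Lemma clustering_ge0 rho i : 0 <= clustering FC rho i 0.
Proof.
by rewrite clusteringE divr_ge0 ?xtanh_ge0 // ltW // clustering_den_gt0.
Qed.

Lemma clustering_le1 rho i : clustering FC rho i 0 <= 1.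
Proof.
rewrite clusteringE ler_pdivrMr ?clustering_den_gt0 // mul1r (bigD1 i) //=.
by rewrite lerDl sumr_ge0 // => j _; exact: xtanh_ge0.
Qed.

Lemma clustering0 i : clustering FC 0 i 0 = (val i == 0)%:R.
Proof.
rewrite clusteringE.
(* At 0 the logits are 1 at index 0 and 0 elsewhere, so the normalization cancels the common factor
   [xtanh 1]. *)
have E k : xtanh (logit k 0) = (val k == 0)%:R * xtanh 1.
  rewrite /logit linear0 mxE ELU0 add0r /xtanh.
  by case: eqP => _; rewrite ?mul1r // !mul0r.
have g1 : xtanh (1 : R) != 0 by rewrite gt_eqF // xtanh_gt0 // oner_eq0.
under eq_bigr do rewrite E; rewrite E (bigD1 (Ordinal q_gt0)) //= big1 ?addr0.
  by rewrite mul1r mulfK.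
move=> k; rewrite -val_eqE /= => /negbTE ->; exact: mul0r.
Qed.

Lemma clustering_C1 i : C1 (fun rho => clustering FC rho i 0).
Proof.
have Clogit j : C1 (logit j).
  apply: C1D; last exact: C1_cst.
  apply: C1_ELU; apply: (@C1_linear _ _ (coord_cV j \o FC)).
  exact: linear_continuous_cV.
have Cg j : C1 (fun rho => xtanh (logit j rho)).
  by apply: C1M => //; apply: C1_tanh; apply: C1M => //; exact: C1_cst.
under eq_fun do rewrite clusteringE.
apply: C1M => //; apply: C1V; last exact: C1_sum.
by move=> rho; rewrite gt_eqF // clustering_den_gt0.
Qed.

Lemma diff_clustering_coord0 i :
  'd (fun rho => clustering FC rho i 0) 0 = 0 :> ('cV[R]_r -> R).
Proof.
have [df _] := clustering_C1 i.
(* Coordinate 0 attains its upper bound 1 at the origin, the others their lower bound 0. *)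
have [i0|i0] := eqVneq (nat_of_ord i) 0%N.
  apply: (@diff_at_max _ _ _ 0 df) => rho.
  by apply: le_trans (clustering_le1 rho i) _; rewrite clustering0 /= i0.
apply: (@diff_at_min _ _ _ 0 df) => rho.
by apply: le_trans (clustering_ge0 rho i); rewrite clustering0 /= (negbTE i0).
Qed.

Lemma is_diff_clustering0 : is_diff 0 (clustering FC) 0.
Proof.
apply: is_diff_cV => i; have [df _] := clustering_C1 i.
apply: DiffDef => //; rewrite diff_clustering_coord0.
by apply/funext => rho; rewrite mxE.
Qed.

Lemma coefE n (W : 'M[R]_(n, q * r)) (At : {linear 'cV[R]_n -> 'M[R]_n}) rho :
  coef FC W At rho =
  \sum_k (clustering FC rho (mxtens_unindex k).1 0 * rho (mxtens_unindex k).2 0)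
      *: At (col k W).
Proof.
rewrite /coef mulmx_sum_col linear_sum; apply: eq_bigr => k _.
rewrite linearZ /kron mxE; congr (_ * _ *: _).
- by congr (clustering FC rho _ _); exact: ord1.
- by congr (rho _ _); exact: ord1.
Qed.

Lemma flat2_coef n (W : 'M[R]_(n, q * r)) (At : {linear 'cV[R]_n -> 'M[R]_n}) :
  flat2 (coef FC W At) (fun rho => \sum_(j < r) rho j 0 *:
    At (col (widen_ord (leq_pmull r q_gt0) j) W)).
Proof.
pose c k rho : R := clustering FC rho (@mxtens_unindex q r k).1 0.
have -> : coef FC W At = fun rho =>
    \sum_k (c k rho * coord_cV (mxtens_unindex k).2 rho) *: At (col k W).
  by apply/funext => rho; rewrite coefE.
have : flat2 (fun rho =>
    \sum_k (c k rho * coord_cV (mxtens_unindex k).2 rho) *: At (col k W))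
   (fun rho =>
    \sum_k (c k 0 * coord_cV (mxtens_unindex k).2 rho) *: At (col k W)).
  apply: flat2_sum => k; apply: flat2Zl; apply: flat2_mul.
  - exact: clustering_C1.
  - exact: diff_clustering_coord0.
  - exact: linear_continuous_cV.
congr flat2; apply/funext => rho; rewrite /c.
under eq_bigr do rewrite clustering0.
(* A column index of [W] becomes a pair (block [i], position [j]); as [c(0)] is the first unit
   vector, only block 0 survives. *)
rewrite (reindex (@mxtens_index q r)); last first.
  apply: onW_bij; exists (@mxtens_unindex q r); first exact: mxtens_indexK.
  exact: mxtens_unindexK.
transitivity (\sum_(i < q) \sum_(j < r)
    ((val i == 0)%:R * coord_cV j rho) *: At (col (mxtens_index (i, j)) W)).
  rewrite pair_bigA; apply: eq_bigr => -[i j] _.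
  by rewrite mxtens_indexK.
rewrite (bigD1 (Ordinal q_gt0)) //= [X in _ + X]big1 ?addr0.
  apply: eq_bigr => j _; rewrite mul1r; congr (_ *: At (col _ _)).
  (* The pair [(0, j)] has index [0 * r + j], so block 0 consists of the first [r] columns of
     [W]. *)
  exact: val_inj.
move=> i; rewrite -val_eqE /= => /negbTE ->.
by rewrite big1 // => j _; rewrite mul0r scale0r.
Qed.

End clustering.

Theorem lemma1 (R : realType) (n r q : nat)
    (n_gt0 : (0 < n)%N) (r_gt0 : (0 < r)%N) (q_gt0 : (0 < q)%N)
    (FC : {linear 'cV[R]_r -> 'cV[R]_q}) (W : 'M[R]_(n, q * r))
    (At : {linear 'cV[R]_n -> 'M[R]_n}) :
  let c : 'cV[R]_r -> 'cV[R]_q := clustering FC in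
  let A : 'cV[R]_r -> 'M[R]_n := coef FC W At in
  let w : 'I_r -> 'cV[R]_n := fun j => col (widen_ord (leq_pmull r q_gt0) j) W in
  let P : 'cV[R]_r -> 'M[R]_n :=
    fun rho => A 0 + \sum_(j < r) rho j 0 *: At (w j) in
  [/\ (forall rho, differentiable A rho),
      differentiable c 0 /\ jacobian_cV c 0 = 0
    & [/\ twice_differentiable A 0,
          taylor2 A 0 = taylor1 A 0,
          taylor1 A 0 = P
        & (fun rho => A rho - P rho) =o_ (0 : 'cV[R]_r)
            (fun rho => `|rho| ^+ 2 : R)]].
Proof.
move=> c A w P.
(* These four facts give in turn (a), the linear term of the expansion, the vanishing of its
   quadratic term, and the remainder in (c). *)
have [dA dA0 ddA oA] := flat2_coef FC q_gt0 W At.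
have [dc dc0] := is_diff_clustering0 FC q_gt0.
split=> //; first by split=> //; apply/matrixP => i j; rewrite mxE dc0 !mxE.
split=> //.
- by split=> [|h]; [near=> y; exact: dA|have [] := ddA h].
- apply/funext => h; have [_ d2] := ddA h.
  have d2h : diff2 A 0 h h = 0 by exact: (congr1 (@^~ h) d2).
  by rewrite /taylor2 d2h scaler0 addr0.
- by apply/funext => h; rewrite /taylor1 dA0.
Unshelve. all: by end_near. Qed.
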